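(* Let $k_1>0$ and $k_2$ be real numbers, let $\tau\in\mathbb{C}$ with $\operatorname{Im}\tau>0$, and let $q=e^{\pi i\tau}$, with $q^s:=e^{\pi i\tau s}$ for real $s$. Then $$\sum_{m=-\infty}^{\infty}q^{k_1m^2+k_2m}=\frac{\left(q^{\frac{k_1+2k_2}{4}},\,q^{\frac{k_1-2k_2}{4}},\,q^{\frac{k_1}{2}}:q^{\frac{k_1}{2}}\right)_\infty+\left(-q^{\frac{k_1+2k_2}{4}},\,-q^{\frac{k_1-2k_2}{4}},\,q^{\frac{k_1}{2}}:q^{\frac{k_1}{2}}\right)_\infty}{2}.$$
   Context: Infinite product notation: $(\alpha:\beta)_\infty=\prod_{k=0}^\infty(1-\alpha\beta^k)$ for $|\beta|<1$, and $(\alpha,\gamma,\dots,\zeta:\beta)_\infty=(\alpha:\beta)_\infty(\gamma:\beta)_\infty\cdots(\zeta:\beta)_\infty$. *)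

(* Defs.v *)
From Stdlib Require Import Reals Lra Lia List ZArith.
From Coquelicot Require Import Coquelicot.
Import ListNotations.

Local Open Scope C_scope.

Definition Cexp (z : C) : C :=
  ((exp (Re z) * cos (Im z))%R, (exp (Re z) * sin (Im z))%R).

(* [q_pow tau s] is q^s for the nome q = e^{pi i tau}, namely e^{pi i tau s};
   this fixes the branch of the power for non-integer [s]. *)
Definition q_pow (tau : C) (s : R) : C :=
  Cexp (PI * Ci * tau * s).

(* Product of the [n] factors k = 0, ..., n-1. *)
Fixpoint qpoch_fin (a b : C) (n : nat) : C :=
  match n with
  | O => 1
  | S m => qpoch_fin a b m * (1 - a * b ^ m)
  end.

(* (a : b)_oo; [lim] is total, and [qpoch_correct] below shows that it is the
   limit of the partial products whenever |b| < 1. *)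
Definition qpoch (a b : C) : C :=
  @lim C_CompleteNormedModule (filtermap (qpoch_fin a b) eventually).

(* (a_1, ..., a_r : b)_oo *)
Definition qpochs (l : list C) (b : C) : C :=
  fold_right (fun a p => qpoch a b * p) 1 l.

(* Sum over all integers: the series over m >= 0 and over m < 0 both converge,
   and their sums add up to [l]. *)
Definition is_Zseries (f : Z -> C) (l : C) : Prop :=
  exists lp ln : C,
    is_series (fun n : nat => f (Z.of_nat n)) lp /\
    is_series (fun n : nat => f (- Z.of_nat (S n))%Z) ln /\
    l = lp + ln.

Lemma qpoch_fin_bound (a b : C) (n : nat) :
  (Cmod b < 1)%R ->
  (Cmod (qpoch_fin a b n) <= exp (Cmod a / (1 - Cmod b)))%R.
Proof.
intros Hb.
assert (Ha := Cmod_ge_0 a). assert (Hb0 := Cmod_ge_0 b).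
assert (H : (Cmod (qpoch_fin a b n)
             <= exp (Cmod a * ((1 - Cmod b ^ n) / (1 - Cmod b))))%R).
{ induction n as [|n IH]; simpl.
  - rewrite Cmod_1.
    replace (Cmod a * ((1 - 1) / (1 - Cmod b)))%R with 0%R by (field; lra).
    rewrite exp_0; lra.
  - rewrite Cmod_mult.
    replace (Cmod a * ((1 - Cmod b * Cmod b ^ n) / (1 - Cmod b)))%R
      with (Cmod a * ((1 - Cmod b ^ n) / (1 - Cmod b)) + Cmod a * Cmod b ^ n)%R
      by (field; lra).
    rewrite exp_plus.
    apply Rmult_le_compat; try apply Cmod_ge_0; [exact IH|].
    apply Rle_trans with (1 + Cmod a * Cmod b ^ n)%R; [|apply exp_ineq1_le].
    unfold Cminus. eapply Rle_trans; [apply Cmod_triangle|].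
    rewrite Cmod_1, Cmod_opp, Cmod_mult, Cmod_pow; lra. }
eapply Rle_trans; [exact H|].
assert (Hle : (Cmod a * ((1 - Cmod b ^ n) / (1 - Cmod b))
               <= Cmod a / (1 - Cmod b))%R).
{ unfold Rdiv. apply Rmult_le_compat_l; [lra|].
  rewrite <- (Rmult_1_l (/ (1 - Cmod b))) at 2.
  apply Rmult_le_compat_r.
  - left; apply Rinv_0_lt_compat; lra.
  - assert (0 <= Cmod b ^ n)%R by (apply pow_le; lra); lra. }
destruct Hle as [Hlt|Heq]; [left; apply exp_increasing, Hlt|rewrite Heq; lra].
Qed.

Lemma qpoch_correct (a b : C) :
  (Cmod b < 1)%R ->
  filterlim (qpoch_fin a b) eventually (locally (qpoch a b)).
Proof.
intros Hb.
assert (Hb0 := Cmod_ge_0 b).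
set (M := exp (Cmod a / (1 - Cmod b))).
set (u := fun n : nat => match n with
  | O => 1 | S m => - (qpoch_fin a b m * (a * b ^ m)) end : C).
assert (Hu : forall n, sum_n u n = qpoch_fin a b n).
{ induction n as [|n IH].
  - rewrite sum_O; reflexivity.
  - rewrite sum_Sn, IH. unfold plus, u; simpl. ring. }
assert (Hex : ex_series u).
{ apply ex_series_incr_1.
  apply (@ex_series_le _ C_CompleteNormedModule _
           (fun n => (M * Cmod a) * Cmod b ^ n)%R).
  - intros n. change (Cmod (- (qpoch_fin a b n * (a * b ^ n)))
                      <= M * Cmod a * Cmod b ^ n)%R.
    rewrite Cmod_opp, !Cmod_mult, Cmod_pow, Rmult_assoc.
    apply Rmult_le_compat_r.
    + apply Rmult_le_pos; [apply Cmod_ge_0|apply pow_le, Cmod_ge_0].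
    + apply qpoch_fin_bound, Hb.
  - apply (@ex_series_scal_l R_AbsRing R_NormedModule (M * Cmod a)%R
      (fun n => Cmod b ^ n)%R).
    apply ex_series_geom. rewrite Rabs_pos_eq; lra. }
destruct Hex as [l Hl].
assert (Hl' : filterlim (qpoch_fin a b) eventually (locally l)).
{ apply filterlim_ext with (2 := Hl). exact Hu. }
assert (PF : ProperFilter (filtermap (qpoch_fin a b) eventually))
  by apply filtermap_proper_filter, eventually_filter.
assert (Hc : @cauchy C_UniformSpace (filtermap (qpoch_fin a b) eventually)).
{ intros eps; exists l. apply Hl'. exists eps; auto. }
intros P [eps HP].
apply (filter_imp (F := filtermap (qpoch_fin a b) eventually)
  (ball (qpoch a b) eps)); [exact HP|].
exact (@complete_cauchy C_CompleteNormedModule _ PF Hc eps).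
Qed.

(* Main.v *)
(* With x = q^((k1+2k2)/4) and y = q^((k1-2k2)/4) one has xy = q^(k1/2), and the
   Jacobi triple product in Ramanujan's form gives
     (x, y, xy : xy)_oo = sum_n (-1)^n x^(n(n+1)/2) y^(n(n-1)/2)
                        = sum_n (-1)^n q^(k1 (n/2)^2 + k2 (n/2)).
   Replacing (x, y) by (-x, -y) removes the sign, so averaging the two products
   keeps exactly the terms of even index n = 2m.
   The triple product itself is the limit of Cauchy's finite identity, whose
   q-binomial coefficients, once multiplied by (b : b)_n, are uniformly bounded
   and tend to 1 (Tannery's theorem). *)

Require Import Defs.
From Stdlib Require Import Reals ZArith List Lra Lia.
From Coquelicot Require Import Coquelicot.
Import ListNotations.

Local Open Scope C_scope.

(* [ring] does not see through [AbelianMonoid.sort C_AbelianMonoid]. *)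
Ltac Cring := match goal with |- @eq _ ?u ?v => change (@eq C u v) end; ring.

(** * Finite sums of complex numbers *)

Lemma C_sum_n_Sn (f : nat -> C) (n : nat) :
  sum_n f (S n) = sum_n f n + f (S n).
Proof. exact (sum_Sn (G := C_AbelianMonoid) f n). Qed.

Lemma C_sum_n_first (f : nat -> C) (n : nat) :
  sum_n f (S n) = f O + sum_n (fun i => f (S i)) n.
Proof.
induction n as [|n IH].
- now rewrite C_sum_n_Sn, !sum_O.
- rewrite C_sum_n_Sn, IH, C_sum_n_Sn. Cring.
Qed.

Lemma C_sum_n_plus (f g : nat -> C) (n : nat) :
  sum_n (fun i => f i + g i) n = sum_n f n + sum_n g n.
Proof. apply (sum_n_plus f g). Qed.

Lemma C_sum_n_scal (a : C) (f : nat -> C) (n : nat) :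
  sum_n (fun i => a * f i) n = a * sum_n f n.
Proof. apply (sum_n_mult_l (K := C_Ring) a f). Qed.

Lemma C_sum_n_rev (f : nat -> C) (n : nat) :
  sum_n (fun i => f (n - i)%nat) n = sum_n f n.
Proof.
induction n as [|n IH]; [now rewrite !sum_O|].
rewrite C_sum_n_first, C_sum_n_Sn, <- IH, Nat.sub_0_r. cbn [Nat.sub]. Cring.
Qed.

Lemma C_sum_n_split (f : nat -> C) (m n : nat) :
  sum_n f (S m + n) = sum_n f m + sum_n (fun i => f (S m + i)%nat) n.
Proof.
induction n as [|n IH].
- rewrite Nat.add_0_r, sum_O, Nat.add_0_r. apply C_sum_n_Sn.
- rewrite Nat.add_succ_r, !C_sum_n_Sn, IH, Nat.add_succ_r. Cring.
Qed.

(** * Gaussian binomial coefficients *)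

(** The Gaussian binomial coefficient, given by a q-Pascal rule so that no division occurs. Where
    the truncated exponent [n' - k'] is wrong, the coefficient beside it vanishes. *)
Fixpoint qbin (b : C) (n k : nat) : C :=
  match k, n with
  | O, _ => 1
  | S _, O => 0
  | S k', S n' => qbin b n' k + b ^ (n' - k') * qbin b n' k'
  end.

Lemma qbin_0_r (b : C) (n : nat) : qbin b n 0 = 1.
Proof. now destruct n. Qed.

Lemma qbin_SS (b : C) (n k : nat) :
  qbin b (S n) (S k) = qbin b n (S k) + b ^ (n - k) * qbin b n k.
Proof. reflexivity. Qed.

Lemma qbin_gt (b : C) (n k : nat) : (n < k)%nat -> qbin b n k = 0.
Proof.
revert k; induction n as [|n IH]; intros [|k] H; try lia; [reflexivity|].
rewrite qbin_SS, !IH by lia. ring.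
Qed.

(** The second q-Pascal rule. Expanding one side by the induction hypothesis and the other by the
    first rule gives the same terms. *)
Lemma qbin_SS' (b : C) (n k : nat) :
  qbin b (S n) (S k) = b ^ S k * qbin b n (S k) + qbin b n k.
Proof.
revert k; induction n as [|n IH]; intros k.
- destruct k as [|k]; simpl; ring.
- rewrite qbin_SS, (IH k) at 1. rewrite (qbin_SS b n k). destruct k as [|k].
  + rewrite !qbin_0_r, !Nat.sub_0_r. cbn [Cpow]. ring.
  + rewrite (IH k) at 1. rewrite (qbin_SS b n k).
    (* The powers of b agree only if n - k is a true successor; otherwise [qbin b n (S k)] is 0. *)
    cbn [Nat.sub]. destruct (Nat.le_gt_cases (S k) n) as [H|H].
    * replace (n - k)%nat with (S (n - S k)) by lia.
      cbn [Cpow]. ring.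
    * rewrite (qbin_gt b n (S k)) by lia. ring.
Qed.

Lemma qbin_fact (b : C) (k m : nat) :
  qbin b (k + m) k * qpoch_fin b b k * qpoch_fin b b m = qpoch_fin b b (k + m).
Proof.
remember (k + m)%nat as n eqn:E.
revert k m E; induction n as [|n IH]; intros k m E.
- replace k with O by lia. replace m with O by lia. simpl. ring.
- destruct k as [|k].
  + simpl in E. subst m. rewrite qbin_0_r. simpl. ring.
  + rewrite qbin_SS. replace (n - k)%nat with m by lia.
    assert (E2 := IH k m ltac:(lia)).
    destruct m as [|m].
    * rewrite (qbin_gt b n (S k)) by lia.
      replace n with k in * by lia. simpl in *.
      transitivity (qbin b k k * qpoch_fin b b k * 1 * (1 - b * b ^ k)); [ring|].
      rewrite E2. ring.
    * assert (E1 := IH (S k) m ltac:(lia)).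
      replace n with (S (k + m)) in * by lia.
      (* The two Pascal terms carry the two parts of 1 - b^(k+m+2) = (1 - b^(m+1)) + b^(m+1) (1 -
         b^(k+1)). *)
      transitivity (qbin b (S (k + m)) (S k) * qpoch_fin b b (S k) * qpoch_fin b b m
                     * (1 - b * b ^ m)
        + b * b ^ m * (1 - b * b ^ k)
           * (qbin b (S (k + m)) k * qpoch_fin b b k * qpoch_fin b b (S m))).
      { cbn [qpoch_fin Cpow]. ring. }
      rewrite E1, E2. cbn [qpoch_fin Cpow]. rewrite Cpow_add_r. ring.
Qed.

(** * Theta terms and Cauchy's finite identity *)

(* [theta_term x y n] is (-1)^n x^(n(n+1)/2) y^(n(n-1)/2), the n-th term of
   Ramanujan's theta series f(-x, -y); the term of index -n is
   [theta_term y x n]. *)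
Fixpoint theta_term (x y : C) (n : nat) : C :=
  match n with
  | O => 1
  | S m => - (theta_term x y m * (x * (x * y) ^ m))
  end.

(* The term of the bilateral series at the integer i - N. *)
Definition theta_shift (x y : C) (N i : nat) : C :=
  if (N <=? i)%nat then theta_term x y (i - N) else theta_term y x (N - i).

Lemma theta_shift_ge (x y : C) (N j : nat) :
  theta_shift x y N (N + j) = theta_term x y j.
Proof.
unfold theta_shift. destruct (Nat.leb_spec N (N + j)); [|lia].
f_equal; lia.
Qed.

Lemma theta_shift_le (x y : C) (i m : nat) :
  theta_shift x y (i + m) i = theta_term y x m.
Proof.
unfold theta_shift. destruct (Nat.leb_spec (i + m) i).
- replace m with O by lia. now replace (i - (i + 0))%nat with O by lia.
- f_equal; lia.
Qed.

Lemma theta_shift_SS (x y : C) (N i : nat) :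
  theta_shift x y (S N) (S i) = theta_shift x y N i.
Proof. reflexivity. Qed.

(** Trades the weight of the first q-Pascal rule for a multiplier independent of i, the one in the
    new factor 1 - x (xy)^M when M grows. *)
Lemma theta_shift_next (x y : C) (M N i : nat) : (i <= M + N)%nat ->
  (x * y) ^ (M + N - i) * theta_shift x y N (S i)
  = - (x * (x * y) ^ M) * theta_shift x y N i.
Proof.
intros Hi. destruct (Nat.le_gt_cases N i) as [H|H].
- destruct (Nat.le_exists_sub N i H) as [j [-> _]].
  rewrite (Nat.add_comm j N), <- Nat.add_succ_r, !theta_shift_ge.
  replace (M + N - (N + j))%nat with (M - j)%nat by lia.
  replace ((x * y) ^ M) with ((x * y) ^ (M - j) * (x * y) ^ j)
    by (rewrite <- Cpow_add_r; f_equal; lia).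
  cbn [theta_term]. ring.
- destruct (Nat.le_exists_sub (S i) N H) as [m [-> _]].
  rewrite (Nat.add_comm m (S i)), theta_shift_le.
  replace (S i + m)%nat with (i + S m)%nat by lia.
  rewrite theta_shift_le.
  replace (M + (i + S m) - i)%nat with (S m + M)%nat by lia.
  rewrite Cpow_add_r. cbn [theta_term Cpow].
  rewrite (Cmult_comm y x). ring.
Qed.

(** The counterpart for the second q-Pascal rule: the multiplier is that of the new factor 1 - y
    (xy)^N when N, and with it the centre, moves up by one. *)
Lemma theta_shift_prev (x y : C) (N i : nat) :
  (x * y) ^ i * theta_shift x y (S N) i
  = - (y * (x * y) ^ N) * theta_shift x y N i.
Proof.
destruct (Nat.le_gt_cases (S N) i) as [H|H].
- destruct (Nat.le_exists_sub (S N) i H) as [j [-> _]].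
  rewrite (Nat.add_comm j (S N)), theta_shift_ge.
  replace (S N + j)%nat with (N + S j)%nat by lia.
  rewrite theta_shift_ge, Cpow_add_r. cbn [theta_term Cpow]. ring.
- destruct (Nat.le_exists_sub i N ltac:(lia)) as [m [-> _]].
  rewrite (Nat.add_comm m i), <- Nat.add_succ_r, !theta_shift_le.
  rewrite Cpow_add_r. cbn [theta_term]. rewrite (Cmult_comm y x). ring.
Qed.

(** Cauchy's identity. Raising M uses the first q-Pascal rule; the case M = 0 is an induction on N
    with the second rule. *)
Lemma finite_triple_product (x y : C) (M N : nat) :
  qpoch_fin x (x * y) M * qpoch_fin y (x * y) N
  = sum_n (fun i => qbin (x * y) (M + N) i * theta_shift x y N i) (M + N).
Proof.
revert N; induction M as [|M IHM]; intros N.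
- induction N as [|N IHN].
  + cbn [Nat.add]. rewrite sum_O. cbn. Cring.
  + cbn [Nat.add qpoch_fin] in *.
    rewrite C_sum_n_first.
    rewrite (sum_n_ext _ (fun i => (x * y) ^ S i * (qbin (x * y) N (S i)
         * theta_shift x y (S N) (S i)) + qbin (x * y) N i * theta_shift x y N i)).
    2:{ intros i. rewrite qbin_SS', theta_shift_SS. Cring. }
    rewrite C_sum_n_plus, <- IHN.
    (* The range is extended to S N, where [qbin] vanishes, so that splitting off index 0 leaves the
       shifted sum. *)
    transitivity (sum_n (fun i => - (y * (x * y) ^ N)
      * (qbin (x * y) N i * theta_shift x y N i)) (S N)
      + 1 * qpoch_fin y (x * y) N).
    { rewrite C_sum_n_scal, C_sum_n_Sn, <- IHN, (qbin_gt _ N (S N)) by lia. Cring. }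
    rewrite (sum_n_ext _ (fun i => (x * y) ^ i * (qbin (x * y) N i * theta_shift x y (S N) i))).
    2:{ intros i.
        transitivity (qbin (x * y) N i * (- (y * (x * y) ^ N) * theta_shift x y N i)); [Cring|].
        rewrite <- theta_shift_prev. Cring. }
    rewrite C_sum_n_first, !qbin_0_r. cbn [Cpow]. Cring.
- cbn [Nat.add qpoch_fin].
  rewrite C_sum_n_first.
  specialize (IHM N).
  assert (step := theta_shift_next x y M N).
  revert IHM step; generalize (M + N)%nat as K; intros K IHM step.
  rewrite (sum_n_ext _ (fun i => qbin (x * y) K (S i) * theta_shift x y N (S i)
    + - (x * (x * y) ^ M) * (qbin (x * y) K i * theta_shift x y N i))).
  2:{ intros i. rewrite qbin_SS. destruct (Nat.le_gt_cases i K) as [H|H].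
      - transitivity (qbin (x * y) K (S i) * theta_shift x y N (S i)
          + qbin (x * y) K i * ((x * y) ^ (K - i) * theta_shift x y N (S i))); [Cring|].
        rewrite step by exact H. Cring.
      - rewrite (qbin_gt _ K i) by lia. Cring. }
  rewrite C_sum_n_plus, C_sum_n_scal, <- IHM.
  transitivity (sum_n (fun i => qbin (x * y) K i * theta_shift x y N i) (S K)
    + - (x * (x * y) ^ M) * (qpoch_fin x (x * y) M * qpoch_fin y (x * y) N)).
  { rewrite C_sum_n_Sn, <- IHM, (qbin_gt _ K (S K)) by lia. Cring. }
  rewrite C_sum_n_first, !qbin_0_r. Cring.
Qed.

(** * Limits of complex sequences and Tannery's theorem *)

Lemma Clim_Cmod (u : nat -> C) (l : C) :
  filterlim u eventually (locally l)
  <-> is_lim_seq (fun n => Cmod (u n - l)) 0%R.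
Proof.
rewrite (filterlim_locally_ball_norm (K := C_AbsRing) (U := C_NormedModule)).
split.
- intros H. apply is_lim_seq_spec. intros eps. generalize (H eps).
  apply filter_imp. intros n Hn. rewrite Rminus_0_r, Rabs_pos_eq by apply Cmod_ge_0.
  exact Hn.
- intros H eps. apply is_lim_seq_spec in H. generalize (H eps).
  apply filter_imp. intros n Hn. rewrite Rminus_0_r, Rabs_pos_eq in Hn by apply Cmod_ge_0.
  exact Hn.
Qed.

Lemma Clim_mult (u v : nat -> C) (l m : C) :
  filterlim u eventually (locally l) -> filterlim v eventually (locally m) ->
  filterlim (fun n => u n * v n) eventually (locally (l * m)).
Proof.
intros Hu Hv.
apply (filterlim_comp_2 (G := locally l) (H := locally m) u v Cmult Hu Hv).
(* [locally_C] passes between the neighbourhoods of C as a product of two lines and those given by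
   the modulus. *)
intros P HP. apply locally_C in HP.
destruct (filterlim_mult (K := C_AbsRing) l m P HP) as [Q R HQ HR HQR].
exists Q R; [apply locally_C, HQ|apply locally_C, HR|exact HQR].
Qed.

Lemma Clim_plus (u v : nat -> C) (l m : C) :
  filterlim u eventually (locally l) -> filterlim v eventually (locally m) ->
  filterlim (fun n => u n + v n) eventually (locally (l + m)).
Proof.
intros Hu Hv.
apply (filterlim_comp_2 (G := locally l) (H := locally m) u v Cplus Hu Hv).
apply (filterlim_plus (K := C_AbsRing) (V := C_NormedModule) l m).
Qed.

(** The sum is cut at a fixed J: the head is a finite sum of null sequences, and the rest is
    dominated by a tail of the convergent series of h. *)
Lemma tannery_R (a : nat -> nat -> R) (h : nat -> R) :
  (forall n j, (j <= n)%nat -> 0 <= a n j <= h j)%R ->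
  ex_series h ->
  (forall j, is_lim_seq (fun n => a n j) 0%R) ->
  is_lim_seq (fun n => sum_n (a n) n) 0%R.
Proof.
intros Ha [H HH] Hlim.
assert (Hh : forall j, (0 <= h j)%R) by (intros j; specialize (Ha j j (le_n j)); lra).
assert (Hfin : forall J, is_lim_seq (fun n => sum_n (a n) J) 0%R).
{ induction J as [|J IH].
  - apply is_lim_seq_ext with (2 := Hlim O). intros n. now rewrite sum_O.
  - apply is_lim_seq_ext with (fun n => sum_n (a n) J + a n (S J))%R.
    { intros n. now rewrite sum_Sn. }
    replace (Finite 0) with (Finite (0 + 0)) by (f_equal; lra).
    apply is_lim_seq_plus'; auto. }
apply is_lim_seq_spec. intros eps.
assert (HH' : is_lim_seq (sum_n h) H) by exact HH.
apply is_lim_seq_spec in HH'.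
(* Two partial sums within eps/4 of H differ by less than eps/2; the head receives the other
   eps/2. *)
destruct (HH' (mkposreal (eps / 4) ltac:(destruct eps; simpl; lra))) as [J HJ].
simpl in HJ.
assert (HF := Hfin J). apply is_lim_seq_spec in HF.
destruct (HF (mkposreal (eps / 2) ltac:(destruct eps; simpl; lra))) as [N HN].
simpl in HN.
exists (N + J)%nat. intros n Hn.
assert (Hsum : forall k, (J + k <= n)%nat ->
  (0 <= sum_n (a n) (J + k) <= sum_n (a n) J + (sum_n h (J + k) - sum_n h J))%R).
{ induction k as [|k IH]; intros Hk.
  - rewrite Nat.add_0_r in *. split; [|lra].
    clear -Ha Hk. induction J as [|J IH].
    + rewrite sum_O. apply Ha; lia.
    + rewrite sum_Sn. apply Rplus_le_le_0_compat; [apply IH; lia|apply Ha; lia].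
  - rewrite Nat.add_succ_r, !sum_Sn. unfold plus; simpl.
    specialize (IH ltac:(lia)). specialize (Ha n (S (J + k)) ltac:(lia)). lra. }
specialize (Hsum (n - J)%nat ltac:(lia)).
replace (J + (n - J))%nat with n in Hsum by lia.
specialize (HN n ltac:(lia)).
assert (H1 := HJ J (le_n J)). assert (H2 := HJ n ltac:(lia)).
apply Rabs_def2 in HN, H1, H2.
rewrite Rminus_0_r, Rabs_pos_eq by lra. lra.
Qed.

(** Writing c = (c - 1) + 1 leaves the convergent series of g plus an error to which the real
    version applies, with majorant (K + 1) |g j|. *)
Lemma tannery_C (c : nat -> nat -> C) (g : nat -> C) (K : R) (l : C) :
  (forall n j, (j <= n)%nat -> Cmod (c n j) <= K)%R ->
  ex_series (fun j => Cmod (g j)) ->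
  (forall j, is_lim_seq (fun n => Cmod (c n j - 1)) 0%R) ->
  is_series g l ->
  filterlim (fun n => sum_n (fun j => c n j * g j) n) eventually (locally l).
Proof.
intros Hc Hg Hlim Hl.
apply filterlim_ext with
  (fun n => sum_n (fun j => (c n j - 1) * g j) n + sum_n g n).
{ intros n. rewrite <- C_sum_n_plus. apply sum_n_ext. intros j. Cring. }
replace l with (0 + l) by ring.
apply Clim_plus; [|exact Hl].
apply Clim_Cmod.
apply is_lim_seq_le_le with (u := fun _ => 0%R)
  (w := fun n => sum_n (fun j => Cmod (c n j - 1) * Cmod (g j))%R n).
- intros n. split; [apply Cmod_ge_0|].
  unfold Cminus at 1. rewrite Copp_0, Cplus_0_r.
  rewrite <- (sum_n_ext (fun j => Cmod ((c n j - 1) * g j))%R)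
    by (intros j; apply Cmod_mult).
  apply (norm_sum_n_m (K := C_AbsRing) (V := C_NormedModule)).
- apply is_lim_seq_const.
- apply tannery_R with (h := fun j => ((K + 1) * Cmod (g j))%R).
  + intros n j Hj. split; [apply Rmult_le_pos; apply Cmod_ge_0|].
    apply Rmult_le_compat_r; [apply Cmod_ge_0|].
    eapply Rle_trans; [apply Cmod_triangle|].
    rewrite Cmod_opp, Cmod_1. apply Rplus_le_compat_r, Hc, Hj.
  + apply (ex_series_scal_l (K := R_AbsRing) (V := R_NormedModule) (K + 1)%R), Hg.
  + intros j. replace (Finite 0) with (Rbar_mult 0 (Cmod (g j))) by (simpl; f_equal; ring).
    apply is_lim_seq_scal_r, Hlim.
Qed.

(** * Absolute convergence, and bounds and limits of central q-binomial coefficients *)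

(** With r = |b|, the factor of index n has modulus at least exp(-r^(n+1)/(1-r)), and these
    exponents form a geometric series. Being positive and independent of n, the bound permits
    uniform division by the partial products. *)
Lemma qpoch_fin_self_lower_bound (b : C) (n : nat) : (Cmod b < 1)%R ->
  (exp (- (Cmod b / (1 - Cmod b) ^ 2)) <= Cmod (qpoch_fin b b n))%R.
Proof.
intros Hb. set (r := Cmod b) in *.
assert (Hr : (0 <= r)%R) by apply Cmod_ge_0.
assert (H : (exp (- (r * (1 - r ^ n) / (1 - r) ^ 2)) <= Cmod (qpoch_fin b b n))%R).
{ induction n as [|n IH].
  - simpl. rewrite Cmod_1. replace (- _)%R with 0%R by (field; lra).
    rewrite exp_0; lra.
  - cbn [qpoch_fin]. rewrite Cmod_mult.
    replace (- (r * (1 - r ^ S n) / (1 - r) ^ 2))%R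
      with (- (r * (1 - r ^ n) / (1 - r) ^ 2) + - (r ^ S n / (1 - r)))%R
      by (simpl; field; lra).
    rewrite exp_plus.
    apply Rmult_le_compat; try (left; apply exp_pos); [exact IH|].
    assert (Hs : (r ^ S n <= r)%R).
    { simpl. rewrite <- (Rmult_1_r r) at 3. apply Rmult_le_compat_l; [lra|].
      rewrite <- (pow1 n). apply pow_incr; lra. }
    assert (Hs0 : (0 <= r ^ S n)%R) by (apply pow_le; lra).
    apply Rle_trans with (1 - r ^ S n)%R.
    (* Inverted, the claim is 1/(1-s) = 1 + s/(1-s) <= 1 + s/(1-r) <= exp(s/(1-r)). *)
    + set (s := (r ^ S n)%R) in *.
      rewrite exp_Ropp.
      rewrite <- (Rinv_inv (1 - s)).
      apply Rinv_le_contravar; [apply Rinv_0_lt_compat; lra|].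
      eapply Rle_trans; [|apply exp_ineq1_le].
      apply Rle_trans with (1 + s / (1 - s))%R; [apply Req_le; field; lra|].
      apply Rplus_le_compat_l, Rmult_le_compat_l; [lra|].
      apply Rinv_le_contravar; lra.
    + change (b * b ^ n) with (b ^ S n).
      assert (Ht := Cmod_triangle (1 - b ^ S n) (b ^ S n)).
      replace (1 - b ^ S n + b ^ S n) with (RtoC 1) in Ht by ring.
      rewrite Cmod_1, Cmod_pow in Ht. fold r in Ht. lra. }
eapply Rle_trans; [|exact H].
assert (Hle : (r * (1 - r ^ n) / (1 - r) ^ 2 <= r / (1 - r) ^ 2)%R).
{ apply Rmult_le_compat_r; [left; apply Rinv_0_lt_compat, pow_lt; lra|].
  rewrite <- (Rmult_1_r r) at 3. apply Rmult_le_compat_l; [lra|].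
  assert (0 <= r ^ n)%R by (apply pow_le; lra). lra. }
destruct Hle as [Hlt|Heq]; [left; apply exp_increasing; lra|rewrite Heq; lra].
Qed.

(** Ratio test: consecutive moduli have ratio |x| |xy|^n, which tends to 0 and so is eventually
    below 1/2. *)
Lemma ex_series_theta_term (x y : C) : (Cmod (x * y) < 1)%R ->
  ex_series (fun n => Cmod (theta_term x y n)).
Proof.
intros Hb. set (r := Cmod (x * y)) in *.
assert (Hr : (0 <= r)%R) by apply Cmod_ge_0.
assert (Hx := Cmod_ge_0 x).
assert (Hlim : is_lim_seq (fun n => Cmod x * r ^ n)%R 0%R).
{ replace (Finite 0) with (Rbar_mult (Cmod x) 0) by (simpl; f_equal; ring).
  apply is_lim_seq_scal_l, is_lim_seq_geom. rewrite Rabs_pos_eq; lra. }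
apply is_lim_seq_spec in Hlim.
destruct (Hlim (mkposreal (1 / 2) ltac:(lra))) as [J HJ]. simpl in HJ.
apply (ex_series_incr_n (K := R_AbsRing) (V := R_NormedModule) _ J).
apply (ex_series_le (K := R_AbsRing) (V := R_CompleteNormedModule) _
  (fun k => Cmod (theta_term x y J) * (1 / 2) ^ k)%R).
- intros k. change (Rabs (Cmod (theta_term x y (J + k)))
    <= Cmod (theta_term x y J) * (1 / 2) ^ k)%R.
  rewrite Rabs_pos_eq by apply Cmod_ge_0.
  induction k as [|k IH]; [rewrite Nat.add_0_r; simpl; lra|].
  rewrite Nat.add_succ_r. cbn [theta_term].
  rewrite Cmod_opp, !Cmod_mult, Cmod_pow. fold r.
  specialize (HJ (J + k)%nat ltac:(lia)). apply Rabs_def2 in HJ.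
  replace (Cmod (theta_term x y J) * (1 / 2) ^ S k)%R
    with (Cmod (theta_term x y J) * (1 / 2) ^ k * (1 / 2))%R by (simpl; ring).
  apply Rmult_le_compat; try apply Cmod_ge_0; try lra.
  apply Rmult_le_pos; [lra|apply pow_le; lra].
- apply (ex_series_scal_l (K := R_AbsRing) (V := R_NormedModule)).
  apply ex_series_geom. rewrite Rabs_pos_eq; lra.
Qed.


(** With P_n = (b : b)_n the quantity is P_n P_(2n) / (P_(n+j) P_(n-j)); the numerator is bounded
    above and the denominator below, uniformly in n and j. *)
Lemma qbin_central_bound (b : C) (n j : nat) : (Cmod b < 1)%R -> (j <= n)%nat ->
  (Cmod (qpoch_fin b b n * qbin b (n + n) (n + j))
   <= exp (Cmod b / (1 - Cmod b)) ^ 2 / exp (- (Cmod b / (1 - Cmod b) ^ 2)) ^ 2)%R.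
Proof.
intros Hb Hj.
assert (E := qbin_fact b (n + j) (n - j)).
replace (n + j + (n - j))%nat with (n + n)%nat in E by lia.
assert (P1 := qpoch_fin_self_lower_bound b (n + j) Hb).
assert (P2 := qpoch_fin_self_lower_bound b (n - j) Hb).
assert (U1 := qpoch_fin_bound b b n Hb).
assert (U2 := qpoch_fin_bound b b (n + n) Hb).
set (mu := exp (- (Cmod b / (1 - Cmod b) ^ 2))) in *.
set (M := exp (Cmod b / (1 - Cmod b))) in *.
assert (Hmu : (0 < mu)%R) by apply exp_pos.
apply (Rmult_le_reg_r (mu ^ 2)); [apply pow_lt, Hmu|].
replace (M ^ 2 / mu ^ 2 * mu ^ 2)%R with (M * M)%R by (field; lra).
apply Rle_trans with (Cmod (qpoch_fin b b n * qbin b (n + n) (n + j))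
  * (Cmod (qpoch_fin b b (n + j)) * Cmod (qpoch_fin b b (n - j))))%R.
- apply Rmult_le_compat_l; [apply Cmod_ge_0|].
  replace (mu ^ 2)%R with (mu * mu)%R by ring. apply Rmult_le_compat; lra.
- rewrite <- !Cmod_mult.
  replace (qpoch_fin b b n * qbin b (n + n) (n + j)
     * (qpoch_fin b b (n + j) * qpoch_fin b b (n - j)))
    with (qpoch_fin b b n * qpoch_fin b b (n + n)) by (rewrite <- E; ring).
  rewrite Cmod_mult. apply Rmult_le_compat; try apply Cmod_ge_0; assumption.
Qed.

Lemma Clim_comp (u : nat -> C) (l : C) (phi : nat -> nat) :
  filterlim phi eventually eventually -> filterlim u eventually (locally l) ->
  filterlim (fun n => u (phi n)) eventually (locally l).
Proof. intros Hphi Hu. exact (filterlim_comp _ _ _ _ _ _ _ _ Hphi Hu). Qed.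

(** The slack k admits maps that lag behind n, such as n - j. *)
Lemma eventually_ge_comp (phi : nat -> nat) (k : nat) :
  (forall n, n <= phi n + k)%nat -> filterlim phi eventually eventually.
Proof.
intros H P [N HN]. exists (N + k)%nat. intros n Hn. apply HN.
specialize (H n). lia.
Qed.

(** Multiplied by P_(n+j) P_(n-j), the difference becomes P_n P_(2n) - P_(n+j) P_(n-j), which tends
    to p^2 - p^2 = 0. The multiplier has modulus at least mu^2, so dividing by it keeps the limit
    0. *)
Lemma qbin_central_lim (b : C) (j : nat) : (Cmod b < 1)%R ->
  is_lim_seq (fun n => Cmod (qpoch_fin b b n * qbin b (n + n) (n + j) - 1)) 0%R.
Proof.
intros Hb.
set (mu := exp (- (Cmod b / (1 - Cmod b) ^ 2))).
assert (Hmu : (0 < mu)%R) by apply exp_pos.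
assert (HP := qpoch_correct b b Hb). set (p := qpoch b b) in *.
assert (HD : is_lim_seq (fun n => Cmod (qpoch_fin b b n * qpoch_fin b b (n + n)
   + - (1) * (qpoch_fin b b (n + j) * qpoch_fin b b (n - j)) - 0)) 0%R).
{ apply Clim_Cmod. replace (RtoC 0) with (p * p + - (1) * (p * p)) by ring.
  apply Clim_plus; [apply Clim_mult|apply Clim_mult; [apply filterlim_const|apply Clim_mult]].
  - exact HP.
  - apply (Clim_comp (qpoch_fin b b)); [|exact HP]. apply eventually_ge_comp with O; lia.
  - apply (Clim_comp (qpoch_fin b b)); [|exact HP]. apply eventually_ge_comp with O; lia.
  - apply (Clim_comp (qpoch_fin b b)); [|exact HP]. apply eventually_ge_comp with j; lia. }
apply (is_lim_seq_scal_r _ (/ mu ^ 2)%R) in HD.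
replace (Rbar_mult 0 (/ mu ^ 2)%R) with (Finite 0) in HD by (simpl; f_equal; ring).
apply is_lim_seq_le_le_loc with (3 := HD) (u := fun _ => 0%R); [|apply is_lim_seq_const].
(* From n = j on, n - j is a true difference. *)
exists j. intros n Hj. split; [apply Cmod_ge_0|].
assert (E := qbin_fact b (n + j) (n - j)).
replace (n + j + (n - j))%nat with (n + n)%nat in E by lia.
assert (P1 := qpoch_fin_self_lower_bound b (n + j) Hb).
assert (P2 := qpoch_fin_self_lower_bound b (n - j) Hb).
fold mu in P1, P2.
rewrite <- E.
replace (_ - 0) with ((qpoch_fin b b n * qbin b (n + n) (n + j) - 1)
  * (qpoch_fin b b (n + j) * qpoch_fin b b (n - j))) by ring.
rewrite !(Cmod_mult (_ - 1)), (Cmod_mult (qpoch_fin b b (n + j))), Rmult_assoc.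
rewrite <- Rmult_1_r at 1. apply Rmult_le_compat_l; [apply Cmod_ge_0|].
apply (Rmult_le_reg_r (mu ^ 2)); [apply pow_lt, Hmu|].
replace (Cmod (qpoch_fin b b (n + j)) * Cmod (qpoch_fin b b (n - j)) * / mu ^ 2 * mu ^ 2)%R
  with (Cmod (qpoch_fin b b (n + j)) * Cmod (qpoch_fin b b (n - j)))%R by (field; lra).
replace (1 * mu ^ 2)%R with (mu * mu)%R by ring. apply Rmult_le_compat; lra.
Qed.

Lemma qpoch_fin_self_neq_0 (b : C) (n : nat) : (Cmod b < 1)%R ->
  qpoch_fin b b n <> 0.
Proof.
intros Hb. apply Cmod_gt_0.
apply Rlt_le_trans with (2 := qpoch_fin_self_lower_bound b n Hb), exp_pos.
Qed.

Lemma qbin_sym (b : C) (k m : nat) : (Cmod b < 1)%R ->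
  qbin b (k + m) k = qbin b (k + m) m.
Proof.
intros Hb.
assert (E1 := qbin_fact b k m). assert (E2 := qbin_fact b m k).
rewrite (Nat.add_comm m k) in E2.
assert (Hk := qpoch_fin_self_neq_0 b k Hb).
assert (Hm := qpoch_fin_self_neq_0 b m Hb).
transitivity (qpoch_fin b b (k + m) / (qpoch_fin b b k * qpoch_fin b b m)).
- rewrite <- E1. field. now split.
- rewrite <- E2. field. now split.
Qed.

(** * Jacobi's triple product as a limit *)

(** Cauchy's identity with M = N = n + 1, times (b : b)_(n+1) and cut at the centre. Since [sum_n]
    always has at least one term, n + 1 is used so that the negative side is never empty. *)
Lemma triple_product_partial (x y : C) (n : nat) : (Cmod (x * y) < 1)%R ->
  qpoch_fin x (x * y) (S n)
    * (qpoch_fin y (x * y) (S n) * qpoch_fin (x * y) (x * y) (S n))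
  = sum_n (fun j => qpoch_fin (x * y) (x * y) (S n)
        * qbin (x * y) (S n + S n) (S n + j) * theta_term x y j) (S n)
    + sum_n (fun j => qpoch_fin (x * y) (x * y) (S n)
        * qbin (x * y) (S n + S n) (S n + S j) * theta_term y x (S j)) n.
Proof.
intros Hb. set (b := x * y) in *.
transitivity (qpoch_fin b b (S n) * (qpoch_fin x b (S n) * qpoch_fin y b (S n)));
  [ring|].
assert (F := finite_triple_product x y (S n) (S n)). fold b in F. rewrite F.
rewrite C_sum_n_split, Cmult_plus_distr_l, <- !C_sum_n_scal, Cplus_comm.
f_equal.
- apply sum_n_ext. intros j. rewrite theta_shift_ge. Cring.
(* Reversed, the lower half is indexed by the distance S j from the centre; symmetry of [qbin] moves
   its coefficient to the upper half. *)
- rewrite <- C_sum_n_rev. apply sum_n_ext_loc. intros j Hj.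
  replace (theta_shift x y (S n) (n - j)) with (theta_term y x (S j))
    by (rewrite <- (theta_shift_le x y (n - j)); f_equal; lia).
  assert (E := qbin_sym b (n - j) (S n + S j) Hb).
  replace (n - j + (S n + S j))%nat with (S n + S n)%nat in E by lia.
  rewrite E. Cring.
Qed.

(** Both sides of the partial identity converge, the right one by Tannery's theorem on each half,
    and limits are unique. *)
Lemma triple_product (x y : C) : (Cmod (x * y) < 1)%R ->
  exists lp ln : C,
    is_series (theta_term x y) lp /\
    is_series (fun n => theta_term y x (S n)) ln /\
    qpoch x (x * y) * (qpoch y (x * y) * qpoch (x * y) (x * y)) = lp + ln.
Proof.
intros Hb.
assert (Hp := ex_series_theta_term x y Hb).
assert (Hn : ex_series (fun n => Cmod (theta_term y x (S n)))).
{ apply (ex_series_incr_1 (fun n => Cmod (theta_term y x n))).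
  apply ex_series_theta_term. now rewrite Cmult_comm. }
destruct (ex_series_le (K := C_AbsRing) (V := C_CompleteNormedModule)
  (theta_term x y) _ (fun n => Rle_refl _) Hp) as [lp Hlp].
destruct (ex_series_le (K := C_AbsRing) (V := C_CompleteNormedModule)
  (fun n => theta_term y x (S n)) _ (fun n => Rle_refl _) Hn) as [ln Hln].
exists lp, ln. split; [exact Hlp|]. split; [exact Hln|].
assert (HS : filterlim S eventually eventually)
  by (apply eventually_ge_comp with O; lia).
set (c := fun n j => qpoch_fin (x * y) (x * y) n * qbin (x * y) (n + n) (n + j)).
assert (Tp := tannery_C c _ _ _
  (fun n j => qbin_central_bound (x * y) n j Hb) Hp
  (fun j => qbin_central_lim (x * y) j Hb) Hlp).
(* The negative half starts at index 1, so both arguments of the weight are shifted by one. *)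
assert (Tn := tannery_C (fun n j => c (S n) (S j)) _ _ _
  (fun n j H => qbin_central_bound (x * y) (S n) (S j) Hb (le_n_S _ _ H)) Hn
  (fun j => is_lim_seq_subseq _ _ S HS (qbin_central_lim (x * y) (S j) Hb)) Hln).
refine (filterlim_locally_unique (K := C_AbsRing) (V := C_NormedModule)
  (F := eventually) (fun n => qpoch_fin x (x * y) (S n)
    * (qpoch_fin y (x * y) (S n) * qpoch_fin (x * y) (x * y) (S n))) _ _ _ _).
- apply (Clim_mult (fun n => qpoch_fin x (x * y) (S n))
    (fun n => qpoch_fin y (x * y) (S n) * qpoch_fin (x * y) (x * y) (S n)));
  [|apply (Clim_mult (fun n => qpoch_fin y (x * y) (S n))
      (fun n => qpoch_fin (x * y) (x * y) (S n)))];
  match goal with |- filterlim (fun n => ?u (S n)) _ _ => apply (Clim_comp u) end;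
  solve [exact HS | apply qpoch_correct, Hb].
- apply filterlim_ext with (f := fun n =>
    sum_n (fun j => c (S n) j * theta_term x y j) (S n)
    + sum_n (fun j => c (S n) (S j) * theta_term y x (S j)) n).
  { intros n. symmetry. apply triple_product_partial, Hb. }
  apply (Clim_plus (fun n => sum_n (fun j => c (S n) j * theta_term x y j) (S n))); [|exact Tn].
  apply (Clim_comp (fun n => sum_n (fun j => c n j * theta_term x y j) n)); [exact HS|exact Tp].
Qed.

(** * Pairing of consecutive terms, and powers of the nome *)

(** The partial sums of the pairs are the odd-indexed partial sums of u. *)
Lemma is_series_pairs (u : nat -> C) (l : C) : is_series u l ->
  is_series (fun m => u (2 * m)%nat + u (S (2 * m))) l.
Proof.
intros H.
assert (E : forall m,
  sum_n u (S (2 * m)) = sum_n (fun m => u (2 * m)%nat + u (S (2 * m))) m).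
{ induction m as [|m IH].
  - now rewrite C_sum_n_Sn, !sum_O.
  - rewrite (C_sum_n_Sn _ m), <- IH.
    replace (2 * S m)%nat with (S (S (2 * m))) by lia.
    rewrite (C_sum_n_Sn u (S (S (2 * m)))), (C_sum_n_Sn u (S (2 * m))). Cring. }
apply (filterlim_ext _ _ E), (Clim_comp (sum_n u)); [|exact H].
apply eventually_ge_comp with O. lia.
Qed.

Lemma Cexp_plus (z w : C) : Cexp (z + w) = Cexp z * Cexp w.
Proof.
unfold Cexp, Cmult, Re, Im; simpl.
rewrite exp_plus, cos_plus, sin_plus. f_equal; ring.
Qed.

Lemma q_pow_plus (tau : C) (s t : R) :
  q_pow tau (s + t) = q_pow tau s * q_pow tau t.
Proof.
unfold q_pow. rewrite <- Cexp_plus. f_equal. rewrite RtoC_plus. ring.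
Qed.

Lemma q_pow_0 (tau : C) : q_pow tau 0 = 1.
Proof.
unfold q_pow. rewrite Cmult_0_r. unfold Cexp; simpl.
rewrite exp_0, cos_0, sin_0. unfold RtoC; f_equal; ring.
Qed.

Lemma q_pow_pow (tau : C) (s : R) (n : nat) :
  q_pow tau s ^ n = q_pow tau (s * INR n).
Proof.
induction n as [|n IH].
- simpl. now rewrite Rmult_0_r, q_pow_0.
- cbn [Cpow]. rewrite IH, <- q_pow_plus, S_INR. f_equal; ring.
Qed.

Lemma Cmod_Cexp (z : C) : Cmod (Cexp z) = exp (Re z).
Proof.
unfold Cmod, Cexp; cbn [fst snd].
transitivity (sqrt (exp (Re z) ^ 2)); [f_equal|apply sqrt_pow2; left; apply exp_pos].
assert (H := sin2_cos2 (Im z)). unfold Rsqr in H.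
transitivity (exp (Re z) ^ 2
  * (sin (Im z) * sin (Im z) + cos (Im z) * cos (Im z)))%R; [|rewrite H]; ring.
Qed.

Lemma Cmod_q_pow (tau : C) (s : R) :
  Cmod (q_pow tau s) = exp (- (PI * Im tau * s)).
Proof.
unfold q_pow. rewrite Cmod_Cexp. f_equal. simpl. unfold Im. ring.
Qed.

(** * Theta terms at powers of the nome, and the average of the two products *)

Lemma theta_term_opp (x y : C) (n : nat) :
  theta_term (- x) (- y) n = (- (1)) ^ n * theta_term x y n.
Proof.
induction n as [|n IH]; [simpl; ring|].
cbn [theta_term Cpow]. rewrite IH.
replace (- x * - y) with (x * y) by ring. ring.
Qed.

(** The minus signs cancel (-1)^n, and the exponents n(n+1)/2 and n(n-1)/2 combine to k1 n^2/4 + k2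
    n/2. At n = 2m this is the summand at m. *)
Lemma theta_term_q_pow (tau : C) (k1 k2 : R) (n : nat) :
  theta_term (- q_pow tau ((k1 + 2 * k2) / 4)) (- q_pow tau ((k1 - 2 * k2) / 4)) n
  = q_pow tau (k1 * (INR n / 2) ^ 2 + k2 * (INR n / 2)).
Proof.
induction n as [|n IH].
- simpl. rewrite <- (q_pow_0 tau). f_equal. field.
- cbn [theta_term]. rewrite IH.
  replace (- q_pow tau ((k1 + 2 * k2) / 4) * - q_pow tau ((k1 - 2 * k2) / 4))
    with (q_pow tau ((k1 + 2 * k2) / 4) * q_pow tau ((k1 - 2 * k2) / 4)) by ring.
  rewrite <- q_pow_plus, q_pow_pow.
  transitivity (q_pow tau (k1 * (INR n / 2) ^ 2 + k2 * (INR n / 2))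
    * (q_pow tau ((k1 + 2 * k2) / 4)
       * q_pow tau (((k1 + 2 * k2) / 4 + (k1 - 2 * k2) / 4) * INR n))); [ring|].
  rewrite <- !q_pow_plus, S_INR. f_equal. field.
Qed.

(** The even terms are expressed at (-x, -y) because [theta_term_q_pow] evaluates them there. *)
Lemma theta_term_even_part (x y : C) (m : nat) :
  theta_term x y (2 * m) + theta_term (- x) (- y) (2 * m)
  = 2 * theta_term (- x) (- y) (2 * m)
  /\ theta_term x y (S (2 * m)) + theta_term (- x) (- y) (S (2 * m)) = 0.
Proof.
rewrite !theta_term_opp, Cpow_S, Cpow_mult_r.
replace ((- (1)) ^ 2) with (RtoC 1) by (simpl; ring).
rewrite Cpow_1_l. split; ring.
Qed.

Theorem lemma6 (k1 k2 : R) (tau : C)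
  (hk1 : (0 < k1)%R) (htau : (0 < Im tau)%R) :
  is_Zseries
    (fun m : Z => q_pow tau (k1 * IZR m ^ 2 + k2 * IZR m)%R)
    ((qpochs [q_pow tau ((k1 + 2 * k2) / 4)%R;
              q_pow tau ((k1 - 2 * k2) / 4)%R;
              q_pow tau (k1 / 2)%R]
             (q_pow tau (k1 / 2)%R)
      + qpochs [- q_pow tau ((k1 + 2 * k2) / 4)%R;
                - q_pow tau ((k1 - 2 * k2) / 4)%R;
                q_pow tau (k1 / 2)%R]
               (q_pow tau (k1 / 2)%R)) / 2)%C.
Proof.
assert (Hb : (Cmod (q_pow tau (k1 / 2)) < 1)%R).
{ rewrite Cmod_q_pow, <- exp_0. apply exp_increasing.
  assert (0 < PI * Im tau * (k1 / 2))%R; [|lra].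
  apply Rmult_lt_0_compat; [|lra]. exact (Rmult_lt_0_compat _ _ PI_RGT_0 htau). }
set (x := q_pow tau ((k1 + 2 * k2) / 4)).
set (y := q_pow tau ((k1 - 2 * k2) / 4)).
assert (Exy : x * y = q_pow tau (k1 / 2)).
{ unfold x, y. rewrite <- q_pow_plus. f_equal. field. }
assert (Exy' : - x * - y = q_pow tau (k1 / 2)) by (rewrite <- Exy; ring).
rewrite <- Exy in Hb.
destruct (triple_product x y Hb) as (p & n & Hp & Hn & E).
destruct (triple_product (- x) (- y)) as (p' & n' & Hp' & Hn' & E').
{ now rewrite Exy', <- Exy. }
rewrite Exy in E. rewrite Exy' in E'.
exists ((p + p') / 2), ((n + n') / 2). split; [|split].
(* In the pair of indices 2m and 2m + 1 the odd term cancels and the even one yields the integer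
   m. *)
- assert (H := is_series_pairs _ _ (is_series_plus _ _ _ _ Hp Hp')).
  apply (is_series_scal (K := C_AbsRing) (V := C_NormedModule) (/ 2)) in H.
  replace ((p + p') / 2) with (scal (/ 2 : C) (plus p p')) by apply Cmult_comm.
  apply is_series_ext with (2 := H). intros m.
  change (/ 2 * (theta_term x y (2 * m) + theta_term (- x) (- y) (2 * m)
    + (theta_term x y (S (2 * m)) + theta_term (- x) (- y) (S (2 * m))))
    = q_pow tau (k1 * IZR (Z.of_nat m) ^ 2 + k2 * IZR (Z.of_nat m))).
  destruct (theta_term_even_part x y m) as [-> ->].
  unfold x, y. rewrite theta_term_q_pow.
  rewrite <- INR_IZR_INZ, mult_INR.
  replace (INR 2 * INR m / 2)%R with (INR m) by (simpl; field).
  field.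
(* This series starts at index 1, so the pairs are 2m + 1 and 2m + 2; the surviving second term
   belongs to the integer -(m + 1). *)
- assert (H := is_series_pairs _ _ (is_series_plus _ _ _ _ Hn Hn')).
  apply (is_series_scal (K := C_AbsRing) (V := C_NormedModule) (/ 2)) in H.
  replace ((n + n') / 2) with (scal (/ 2 : C) (plus n n')) by apply Cmult_comm.
  apply is_series_ext with (2 := H). intros m.
  change (/ 2 * (theta_term y x (S (2 * m)) + theta_term (- y) (- x) (S (2 * m))
    + (theta_term y x (S (S (2 * m))) + theta_term (- y) (- x) (S (S (2 * m)))))
    = q_pow tau (k1 * IZR (- Z.of_nat (S m)) ^ 2 + k2 * IZR (- Z.of_nat (S m)))).
  rewrite (proj2 (theta_term_even_part y x m)).
  replace (S (S (2 * m))) with (2 * S m)%nat by lia.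
  rewrite (proj1 (theta_term_even_part y x (S m))).
  unfold x, y.
  (* Exchanging x and y amounts to changing the sign of k2. *)
  replace (k1 + 2 * k2)%R with (k1 - 2 * - k2)%R by ring.
  replace (k1 - 2 * k2)%R with (k1 + 2 * - k2)%R by ring.
  rewrite theta_term_q_pow, opp_IZR, <- INR_IZR_INZ, mult_INR.
  replace (INR 2 * INR (S m) / 2)%R with (INR (S m)) by (simpl (INR 2); field).
  replace (k1 * (- INR (S m)) ^ 2 + k2 * - INR (S m))%R
    with (k1 * INR (S m) ^ 2 + - k2 * INR (S m))%R by ring.
  field.
- unfold qpochs, fold_right. rewrite !Cmult_1_r, E, E'. field.
Qed.
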